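(* Let $\mathbf F:\mathbb R^d\to\mathbb R^d$ be differentiable with Jacobian $\mathbf J$, and let $L_1,L_2\ge 0$ and $M>0$ be constants such that for all $\mathbf x,\mathbf y\in\mathbb R^d$: (i) $\|\mathbf J(\mathbf x)\|\le L_1$ and $\|\mathbf J(\mathbf x)-\mathbf J(\mathbf y)\|\le L_2\|\mathbf x-\mathbf y\|$; (ii) $\|\mathbf F(\mathbf y)\|^2\le\|\mathbf F(\mathbf x)+\mathbf J(\mathbf x)(\mathbf y-\mathbf x)\|^2+M\|\mathbf y-\mathbf x\|^3$. Let $m\ge1$ be an integer, let $\mathbf x_0\in\mathbb R^d$, and let $(\mathbf x_t)_{t\ge0}$ be generated by the GRLM method with period $m$ and regularization constant $c=\max\{4L_1L_2m,\,M\}$, started at $\mathbf x_0$. Then for every $\epsilon>0$ the method takes at most $$T=\mathcal O\big(m^2+m^{-0.5}\epsilon^{-2.5}\big)$$ iterations to find an $\epsilon$-stationary point of $\phi(\mathbf x)=\frac12\|\mathbf F(\mathbf x)\|^2$, i.e. $\min_{t=0,\dots,T-1}\|\mathbf J(\mathbf x_t)^\top\mathbf F(\mathbf x_t)\|\le\epsilon$. Explicitly: there is a constant $C>0$ depending only on $L_1,L_2,M$ and $\|\mathbf F(\mathbf x_0)\|$ (not on $d$, $m$, $\epsilon$) such that $\min_{0\le t\le T-1}\|\mathbf J(\mathbf x_t)^\top\mathbf F(\mathbf x_t)\|\le\epsilon$ for every integer $T\ge C\,(m^2+m^{-0.5}\epsilon^{-2.5})$.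
   Context: $\|\cdot\|$ is the Euclidean norm of vectors and the spectral norm of matrices. $\mathbf J(\mathbf x)\in\mathbb R^{d\times d}$ is the Jacobian of $\mathbf F$ at $\mathbf x$, and $\mathbf I$ is the identity matrix. A point $\mathbf x$ is an $\epsilon$-stationary point of $\phi=\frac12\|\mathbf F(\cdot)\|^2$ if $\|\mathbf J(\mathbf x)^\top\mathbf F(\mathbf x)\|\le\epsilon$. GRLM (Gram-Reduced Levenberg--Marquardt) method with integer period $m\ge1$, constant $c>0$ and starting point $\mathbf x_0$: for $t=0,1,2,\dots$ put $\pi(t)=m\lfloor t/m\rfloor$, $\mathbf z_t=\mathbf x_{\pi(t)}$, $\lambda_t=\sqrt{c\,\|\mathbf J(\mathbf x_t)^\top\mathbf F(\mathbf x_t)\|}$, and $$\mathbf x_{t+1}=\mathbf x_t-\big(\mathbf J(\mathbf z_t)^\top\mathbf J(\mathbf z_t)+\lambda_t\mathbf I\big)^{-1}\mathbf J(\mathbf x_t)^\top\mathbf F(\mathbf x_t).$$ If $\mathbf J(\mathbf x_t)^\top\mathbf F(\mathbf x_t)=\mathbf 0$, the step is understood to be zero, i.e. $\mathbf x_{t+1}=\mathbf x_t$. *)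

(* Defs.v *)
From HB Require Import structures.
From mathcomp Require Import all_boot all_order all_algebra.
From mathcomp Require Import all_classical all_reals all_analysis.

Set Implicit Arguments.
Unset Strict Implicit.
Unset Printing Implicit Defensive.

Import Order.TTheory GRing.Theory Num.Theory.
Import numFieldNormedType.Exports.

Local Open Scope classical_set_scope.
Local Open Scope ring_scope.

(* Points of R^d are column vectors.  The
   norm that MathComp-Analysis puts on matrices is the maximum norm; it is used
   only through the topology (differentiability), where the choice of norm is
   immaterial.  All metric quantities use [enorm] and [specnorm]. *)

Definition enorm (R : realType) (d : nat) (v : 'cV[R]_d) : R :=
  Num.sqrt (\sum_(i < d) v i 0 ^+ 2).

(* Spectral norm: the operator norm induced by the Euclidean norm. *)
Definition specnorm (R : realType) (d : nat) (A : 'M[R]_d) : R :=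
  sup [set enorm (A *m v) | v in [set v : 'cV[R]_d | enorm v <= 1]].

(* The library's [jacobian] is for row vectors and is the transpose of the usual
   Jacobian matrix, whose (i, j) entry is the j-th partial derivative of the
   i-th component. *)
Definition Jac (R : realType) (d : nat) (F : 'cV[R]_d -> 'cV[R]_d)
    (x : 'cV[R]_d) : 'M[R]_d :=
  \matrix_(i, j) ('D_(delta_mx j 0) F x) i 0.

Lemma JacE (R : realType) (d : nat) (F : 'cV[R]_d -> 'cV[R]_d)
    (x v : 'cV[R]_d) :
  differentiable F x -> 'd F x v = Jac F x *m v.
Proof.
move=> dF; rewrite {1}[v]matrix_sum_delta linear_sum /=.
apply/matrixP => i k; rewrite ord1 summxE mxE.
apply: eq_bigr => j _; rewrite big_ord1 linearZ /= !mxE deriveE //.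
by rewrite mulrC.
Qed.

(* J(x)^T F(x), the gradient of |F|^2 / 2 at x. *)
Definition JtF (R : realType) (d : nat) (F : 'cV[R]_d -> 'cV[R]_d)
    (x : 'cV[R]_d) : 'cV[R]_d :=
  (Jac F x)^T *m F x.

Definition eps_stationary (R : realType) (d : nat)
    (F : 'cV[R]_d -> 'cV[R]_d) (eps : R) (x : 'cV[R]_d) : Prop :=
  enorm (JtF F x) <= eps.

Definition grlm_lambda (R : realType) (d : nat) (F : 'cV[R]_d -> 'cV[R]_d)
    (c : R) (x : 'cV[R]_d) : R :=
  Num.sqrt (c * enorm (JtF F x)).

(* One step from x with reference point z.  For c > 0 and JtF F x != 0 the
   matrix is positive definite, so [invmx] is its inverse. *)
Definition grlm_step (R : realType) (d : nat) (F : 'cV[R]_d -> 'cV[R]_d)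
    (c : R) (z x : 'cV[R]_d) : 'cV[R]_d :=
  if JtF F x == 0 then x
  else x - invmx ((Jac F z)^T *m Jac F z + (grlm_lambda F c x)%:M) *m JtF F x.

Definition GRLM (R : realType) (d : nat) (F : 'cV[R]_d -> 'cV[R]_d)
    (m : nat) (c : R) (x0 : 'cV[R]_d) (x : nat -> 'cV[R]_d) : Prop :=
  x 0%N = x0 /\
  forall t : nat, x t.+1 = grlm_step F c (x (m * (t %/ m))%N) (x t).

(* Main.v *)
Require Import Defs.
From HB Require Import structures.
From mathcomp Require Import all_boot all_order all_algebra.
From mathcomp Require Import all_classical all_reals all_analysis.
From mathcomp Require Import ring lra.

Import Order.TTheory GRing.Theory Num.Theory.
Import numFieldNormedType.Exports.

Local Open Scope classical_set_scope.
Local Open Scope ring_scope.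

(** Write g_t for the gradient J(x_t)^T F(x_t), s_t for the step, r_t for its
length, and call

  q_t = |J(z_t) s_t|^2 + lambda_t r_t^2 = - <g_t, s_t>

the energy of the step.  The proof plays a lower bound on q_t off against a
bound on the sum of all q_t.

Upper bound on the sum.  The cubic model of |F|^2 along s_t decreases by about
q_t; two errors must be absorbed.  The choice of lambda_t gives c r_t <=
lambda_t, so that the cubic remainder M r_t^3 is at most lambda_t r_t^2.  The
use of the stale Jacobian J(z_t) costs 2 L1 L2 |x_t - z_t| r_t^2
([grlm_descent]).  The drift |x_t - z_t| is at most the sum of the earlier
steps of the epoch, and by Young's inequality these costs sum over an epoch to
at most 2 L1 L2 m sum r_t^3, hence to at most (c / 2) sum r_t^3, which the
remaining part of the energies covers ([epoch_descent]).  Thus the q_t sum to at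
most 2 |F(x_0)|^2.

Lower bound on the energy.  Since s_t solves the damped system B s_t = - g_t,
where B <= (L1^2 + lambda_t) I, one has
|g_t|^2 <= (L1^2 + lambda_t) q_t ([grad_le_energy]).  It matters that
q_t contains |J(z_t) s_t|^2: the summand lambda_t r_t^2 alone gives a rate
c^(-1/2) eps^(-5/2), which lacks the factor m^(-1/2) when L1 L2 = 0, because c
does not grow with m in that case.  If |g_t| > eps, then lambda_t =
O(m^(1/2) |g_t|^(1/2)) shows that 1 / q_t is
O(eps^-2 + m^(1/2) eps^(-3/2)), and both of these terms are at most
m^2 + m^(-1/2) eps^(-5/2) ([rate_interpolation]).  Summing q_t over a run
without stationary point bounds its length. *)

(** * Euclidean geometry of column vectors *)

Definition dot {R : realType} {d : nat} (u v : 'cV[R]_d) : R :=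
  (u^T *m v) 0 0.

Section Euclidean.
Context {R : realType} {d : nat}.
Implicit Types (u v w : 'cV[R]_d) (A : 'M[R]_d).

Lemma dotE u v : dot u v = \sum_(i < d) u i 0 * v i 0.
Proof. by rewrite /dot mxE; apply: eq_bigr => i _; rewrite mxE. Qed.

Lemma dotC u v : dot u v = dot v u.
Proof. by rewrite !dotE; apply: eq_bigr => i _; rewrite mulrC. Qed.

Lemma dotDr u v w : dot u (v + w) = dot u v + dot u w.
Proof. by rewrite /dot mulmxDr mxE. Qed.

Lemma dotDl u v w : dot (v + w) u = dot v u + dot w u.
Proof. by rewrite !(dotC _ u) dotDr. Qed.

Lemma dotZr a u v : dot u (a *: v) = a * dot u v.
Proof. by rewrite /dot -scalemxAr mxE. Qed.

Lemma dotZl a u v : dot (a *: u) v = a * dot u v.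
Proof. by rewrite dotC dotZr dotC. Qed.

Lemma dotNr u v : dot u (- v) = - dot u v.
Proof. by rewrite -scaleN1r dotZr mulN1r. Qed.

Lemma dotNl u v : dot (- u) v = - dot u v.
Proof. by rewrite dotC dotNr dotC. Qed.

Lemma dot_mulmx A u v : dot (A *m u) v = dot u (A^T *m v).
Proof. by rewrite /dot trmx_mul -mulmxA. Qed.

Lemma enorm_ge0 u : 0 <= enorm u.
Proof. exact: sqrtr_ge0. Qed.

Lemma enorm_sqr u : enorm u ^+ 2 = dot u u.
Proof.
rewrite /enorm sqr_sqrtr; last by apply: sumr_ge0 => i _; exact: sqr_ge0.
by rewrite dotE; apply: eq_bigr => i _; rewrite expr2.
Qed.

Lemma enorm_eq0 u : enorm u = 0 -> u = 0.
Proof.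
move=> u0; have /eqP : \sum_(i < d) u i 0 ^+ 2 = 0.
  by rewrite -[RHS](mulr0 (enorm u)) -{2}u0 -expr2 enorm_sqr dotE; apply: eq_bigr.
rewrite psumr_eq0 => [/allP z|i _]; last exact: sqr_ge0.
apply/matrixP => i j; rewrite ord1 mxE.
by have := z i (mem_index_enum _); rewrite /= sqrf_eq0 => /eqP.
Qed.

Lemma enorm0 : enorm (0 : 'cV[R]_d) = 0.
Proof. by apply/eqP; rewrite -sqrf_eq0 enorm_sqr /dot mulmx0 mxE. Qed.

Lemma enormZ a u : 0 <= a -> enorm (a *: u) = a * enorm u.
Proof.
move=> a0; apply/eqP; rewrite -(@eqrXn2 _ 2%N) ?mulr_ge0 ?enorm_ge0//.
by rewrite exprMn !enorm_sqr dotZr dotZl mulrA expr2.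
Qed.

Lemma enormN u : enorm (- u) = enorm u.
Proof.
by apply/eqP; rewrite -(@eqrXn2 _ 2%N) ?enorm_ge0// !enorm_sqr dotNr dotNl opprK.
Qed.

Lemma enorm_sqrD u v :
  enorm (u + v) ^+ 2 = enorm u ^+ 2 + 2 * dot u v + enorm v ^+ 2.
Proof. by rewrite !enorm_sqr dotDr !dotDl (dotC v u); ring. Qed.

Lemma enorm_sqrB u v :
  enorm u ^+ 2 - enorm v ^+ 2 = dot (u - v) (u + v).
Proof. by rewrite !enorm_sqr dotDr !dotDl !dotNl (dotC v u); ring. Qed.

(** Expanding the square of | |v| u - |u| v | gives the inequality multiplied
by |u| |v|. *)
Lemma cauchy_schwarz u v : dot u v <= enorm u * enorm v.
Proof.
have u_ge0 := enorm_ge0 u; have v_ge0 := enorm_ge0 v.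
have [uv0|uv_neq0] := eqVneq (enorm u * enorm v) 0.
  move/eqP: (uv0); rewrite mulf_eq0 => /orP[]/eqP z; rewrite uv0 (enorm_eq0 _ z).
    by rewrite /dot trmx0 mul0mx mxE.
  by rewrite /dot mulmx0 mxE.
have uv_gt0 : 0 < enorm u * enorm v by rewrite lt0r uv_neq0 mulr_ge0.
have := sqr_ge0 (enorm (enorm v *: u - enorm u *: v)).
rewrite enorm_sqr dotDr !dotDl !dotNr !dotNl !dotZr !dotZl.
rewrite -!enorm_sqr (dotC v u) => h.
rewrite -(ler_pM2l uv_gt0); lra.
Qed.

Lemma enormD u v : enorm (u + v) <= enorm u + enorm v.
Proof.
rewrite -(@ler_pXn2r _ 2%N) ?nnegrE ?addr_ge0 ?enorm_ge0//.
by rewrite sqrrD enorm_sqrD; have := cauchy_schwarz u v; lra.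
Qed.

(** The Frobenius bound serves to know that the supremum in [specnorm] is taken
over a bounded set. *)
Lemma enorm_mulmx_frob A u :
  enorm (A *m u) <= Num.sqrt (\sum_(i < d) enorm (row i A)^T ^+ 2) * enorm u.
Proof.
rewrite -(@ler_pXn2r _ 2%N) ?nnegrE ?mulr_ge0 ?enorm_ge0 ?sqrtr_ge0//.
rewrite enorm_sqr dotE exprMn [Num.sqrt _ ^+ 2]sqr_sqrtr; last first.
  by apply: sumr_ge0 => i _; exact: sqr_ge0.
rewrite mulr_suml.
apply: ler_sum => i _.
have -> : (A *m u) i 0 = dot (row i A)^T u.
  by rewrite /dot trmxK -row_mul [RHS]mxE.
rewrite -expr2 -exprMn -[X in X <= _]real_normK ?num_real//.
rewrite ler_pXn2r ?nnegrE ?mulr_ge0 ?enorm_ge0// ler_norml.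
have := cauchy_schwarz (row i A)^T u.
have := cauchy_schwarz (- (row i A)^T) u.
by rewrite dotNl enormN => ? ?; apply/andP; split; lra.
Qed.

Lemma enorm_mulmx A u : enorm (A *m u) <= specnorm A * enorm u.
Proof.
have [/enorm_eq0 ->|u_neq0] := eqVneq (enorm u) 0.
  by rewrite mulmx0 enorm0 mulr0.
have u_gt0 : 0 < enorm u by rewrite lt0r u_neq0 enorm_ge0.
rewrite -ler_pdivrMr// mulrC -enormZ ?invr_ge0 ?enorm_ge0// scalemxAr.
apply: sup_upper_bound; last first.
  by exists ((enorm u)^-1 *: u); rewrite //= enormZ ?invr_ge0 ?enorm_ge0// mulVf.
split; first by exists (enorm (A *m 0)); exists 0; rewrite //= enorm0 ler01.
exists (Num.sqrt (\sum_(i < d) enorm (row i A)^T ^+ 2)) => _ [v /= v1 <-].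
by apply: (le_trans (enorm_mulmx_frob A v)); rewrite ler_piMr ?sqrtr_ge0.
Qed.

End Euclidean.

(** * The damped Gram system *)

Definition damped_gram {R : realType} {d : nat} (J : 'M[R]_d) (l : R) : 'M[R]_d :=
  J^T *m J + l%:M.

(** The quadratic form of [damped_gram J l], in the form that makes its sign
visible. *)
Definition energy {R : realType} {d : nat} (J : 'M[R]_d) (l : R)
    (u : 'cV[R]_d) : R :=
  enorm (J *m u) ^+ 2 + l * enorm u ^+ 2.

Section DampedGram.
Context {R : realType} {d : nat} (J : 'M[R]_d) (l : R).
Implicit Types u v g s : 'cV[R]_d.

Lemma dot_damped_gram u v :
  dot u (damped_gram J l *m v) = dot (J *m u) (J *m v) + l * dot u v.
Proof. by rewrite mulmxDl dotDr -mulmxA -dot_mulmx mul_scalar_mx dotZr. Qed.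

Lemma energyE u : energy J l u = dot u (damped_gram J l *m u).
Proof. by rewrite dot_damped_gram /energy !enorm_sqr. Qed.

(** A vector of the kernel has zero energy, and the energy dominates
[l * enorm u ^+ 2]. *)
Lemma damped_gram_unit : 0 < l -> damped_gram J l \in unitmx.
Proof.
move=> l_gt0; rewrite -row_free_unit -kermx_eq0; apply/eqP/row_matrixP => i.
rewrite row0; set w := row i _.
have wB : w *m damped_gram J l = 0 by apply/sub_kermxP/row_sub.
have Bw : damped_gram J l *m w^T = 0.
  rewrite -[LHS]trmxK trmx_mul trmxK [X in w *m X](_ : _ = damped_gram J l).
    by rewrite wB trmx0.
  by rewrite /damped_gram linearD /= trmx_mul trmxK tr_scalar_mx.
have := energyE w^T; rewrite Bw /dot mulmx0 mxE => e0.
have : l * enorm w^T ^+ 2 <= 0.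
  by rewrite -e0 /energy lerDr sqr_ge0.
rewrite pmulr_rle0// => w_le0.
have /enorm_eq0 : enorm w^T = 0.
  by apply/eqP; rewrite -sqrf_eq0 eq_le w_le0 sqr_ge0.
by move/(congr1 trmx); rewrite trmxK trmx0.
Qed.

Lemma energy_ge0 u : 0 <= l -> 0 <= energy J l u.
Proof. by move=> l0; apply: addr_ge0; rewrite ?sqr_ge0// mulr_ge0 ?sqr_ge0. Qed.

Lemma energy_le L u :
  specnorm J <= L -> energy J l u <= (L ^+ 2 + l) * enorm u ^+ 2.
Proof.
move=> JL; have Ju : enorm (J *m u) <= L * enorm u.
  by apply: le_trans (enorm_mulmx _ _) _; rewrite ler_wpM2r ?enorm_ge0.
rewrite mulrDl lerD2r -exprMn ler_pXn2r// nnegrE ?enorm_ge0//.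
exact: le_trans (enorm_ge0 _) Ju.
Qed.

Section Solution.
Variables (g s : 'cV[R]_d).
Hypothesis gs : damped_gram J l *m s = - g.

Lemma dot_damped_solution : dot g s = - energy J l s.
Proof. by rewrite energyE gs dotNr opprK dotC. Qed.

(** This is |g|^2 <= K <g, B^-1 g> for B <= K I.  It comes from the sign of the
energy along the line g + k s, whose cross term is <g, B s> = - |g|^2. *)
Lemma grad_le_energy L :
  0 <= l -> specnorm J <= L -> enorm g ^+ 2 <= (L ^+ 2 + l) * energy J l s.
Proof.
move=> l0 JL; set K := L ^+ 2 + l; have K_ge0 : 0 <= K by rewrite addr_ge0 ?sqr_ge0.
have parabola k :
    0 <= K * enorm g ^+ 2 - 2 * k * enorm g ^+ 2 + k ^+ 2 * energy J l s.
  have : 0 <= energy J l (g + k *: s) by exact: energy_ge0.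
  have -> : energy J l (g + k *: s) =
      energy J l g + 2 * k * dot g (damped_gram J l *m s) + k ^+ 2 * energy J l s.
    rewrite !energyE !dot_damped_gram !mulmxDr !dotDr !dotDl -!scalemxAr.
    by rewrite !dotZr !dotZl (dotC s g) (dotC (J *m s) (J *m g)); ring.
  by rewrite gs dotNr -enorm_sqr; have := energy_le L g JL; rewrite -/K; lra.
(* The parabola is optimal at k = K; for K = 0 all energies vanish and any
   positive k will do. *)
have [K0|K_neq0] := eqVneq K 0.
  have := energy_le L s JL; have := parabola 1; rewrite -/K K0; lra.
have K_gt0 : 0 < K by rewrite lt0r K_neq0.
by rewrite -(ler_pM2l K_gt0); have := parabola K; lra.
Qed.

(** The energy of [s] equals - <g, s> and is at least
[l * enorm s ^+ 2]. *)
Lemma damped_solution_norm : 0 <= l -> l * enorm s <= enorm g.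
Proof.
move=> l0; have [->|s_neq0] := eqVneq (enorm s) 0; first by rewrite mulr0 enorm_ge0.
have s_gt0 : 0 < enorm s by rewrite lt0r s_neq0 enorm_ge0.
rewrite -(ler_pM2r s_gt0).
have := cauchy_schwarz (- g) s; rewrite dotNl dot_damped_solution opprK enormN.
by apply: le_trans; rewrite -mulrA -expr2 lerDr sqr_ge0.
Qed.

End Solution.
End DampedGram.

(** * One step of the method *)

Section Step.
Context {R : realType} {d : nat} (F : 'cV[R]_d -> 'cV[R]_d).
Variables (c : R) (z x : 'cV[R]_d).
Hypothesis c_gt0 : 0 < c.

Let l := grlm_lambda F c x.
Let s := grlm_step F c z x - x.

Lemma grlm_lambda_gt0 : JtF F x != 0 -> 0 < l.
Proof.
move=> g_neq0; rewrite sqrtr_gt0 mulr_gt0// lt0r enorm_ge0 andbT.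
by apply: contra g_neq0 => /eqP/enorm_eq0 ->.
Qed.

Lemma grlm_step_solves : damped_gram (Jac F z) l *m s = - JtF F x.
Proof.
rewrite /s /grlm_step; case: eqVneq => [->|g_neq0].
  by rewrite subrr mulmx0 oppr0.
rewrite addrC addKr mulmxN mulKVmx//.
exact/damped_gram_unit/grlm_lambda_gt0.
Qed.

(** Here the square root in the regularization pays off: lambda r <= |g| and
lambda^2 = c |g| give c r <= lambda, so the damping dominates the cubic term. *)
Lemma grlm_step_cubic : c * enorm s ^+ 3 <= l * enorm s ^+ 2.
Proof.
have [g0|g_neq0] := eqVneq (JtF F x) 0.
  by rewrite /s /grlm_step g0 eqxx subrr enorm0 !expr0n !mulr0.
have l_gt0 := grlm_lambda_gt0 g_neq0.
rewrite exprS mulrA ler_wpM2r ?sqr_ge0// -(ler_pM2l l_gt0) mulrCA.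
rewrite -[leRHS]expr2 sqr_sqrtr ?mulr_ge0 ?enorm_ge0 ?(ltW c_gt0)//.
rewrite ler_pM2l//.
exact: (damped_solution_norm _ _ _ _ grlm_step_solves (ltW l_gt0)).
Qed.

(** By J^T F = g the linear term of |F + J s|^2 is 2 <g, s>, that is, minus
twice the energy.  Replacing J(x) by J(z) in the quadratic term costs
|J(x) s|^2 - |J(z) s|^2 = <(J(x) - J(z)) s, (J(x) + J(z)) s>, the last summand
of the bound. *)
Lemma grlm_descent L1 L2 M :
  0 <= L1 -> 0 <= L2 -> M <= c ->
  (forall u, specnorm (Jac F u) <= L1) ->
  (forall u v, specnorm (Jac F u - Jac F v) <= L2 * enorm (u - v)) ->
  (forall u v, enorm (F v) ^+ 2 <=
     enorm (F u + Jac F u *m (v - u)) ^+ 2 + M * enorm (v - u) ^+ 3) ->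
  enorm (F (grlm_step F c z x)) ^+ 2 <=
    enorm (F x) ^+ 2 - energy (Jac F z) l s / 2 - c / 2 * enorm s ^+ 3
    + 2 * L1 * L2 * enorm (x - z) * enorm s ^+ 2.
Proof.
have combine (P A B lr M3 r3 X : R) : M3 <= c * r3 -> A - B <= X -> c * r3 <= lr ->
    0 <= B -> P - 2 * (B + lr) + A + M3 <= P - (B + lr) / 2 - c / 2 * r3 + X.
  by lra.
move=> L1_ge0 L2_ge0 Mc J_le J_lip F_le.
have s_ge0 := enorm_ge0 s.
apply: le_trans (F_le x _) _; rewrite -/s.
have Ms : M * enorm s ^+ 3 <= c * enorm s ^+ 3.
  by rewrite ler_wpM2r ?exprn_ge0.
have := grlm_step_cubic.
have -> : enorm (F x + Jac F x *m s) ^+ 2 =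
    enorm (F x) ^+ 2 - 2 * energy (Jac F z) l s + enorm (Jac F x *m s) ^+ 2.
  have := dot_damped_solution _ _ _ _ grlm_step_solves.
  rewrite /JtF dotC -[in LHS](trmxK (Jac F x)) -dot_mulmx trmxK dotC => Fs.
  by rewrite enorm_sqrD Fs; ring.
have : enorm (Jac F x *m s) ^+ 2 - enorm (Jac F z *m s) ^+ 2 <=
    2 * L1 * L2 * enorm (x - z) * enorm s ^+ 2.
  rewrite enorm_sqrB -mulmxBl.
  apply: le_trans (cauchy_schwarz _ _) _.
  have -> : 2 * L1 * L2 * enorm (x - z) * enorm s ^+ 2 =
      (L2 * enorm (x - z) * enorm s) * (2 * L1 * enorm s) by ring.
  apply: ler_pM; rewrite ?enorm_ge0//.
    by apply: le_trans (enorm_mulmx _ _) _; rewrite ler_wpM2r.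
  have J_s u : enorm (Jac F u *m s) <= L1 * enorm s.
    by apply: le_trans (enorm_mulmx _ _) _; rewrite ler_wpM2r.
  apply: le_trans (enormD _ _) _.
  by rewrite -mulrA mulr_natl mulr2n lerD.
move=> Jx_le cubic.
have := sqr_ge0 (enorm (Jac F z *m s)).
exact: combine Ms Jx_le cubic.
Qed.

End Step.

(** * Summation over an epoch *)

Section Epochs.
Context {R : realType}.
Implicit Types r Phi q : nat -> R.

(** Young's inequality 3 u v^2 <= u^3 + 2 v^3 applied to each product of an
earlier step with the square of a later one. *)
Lemma sum_prefix_sqr_le r (j : nat) :
  (forall i, 0 <= r i) ->
  \sum_(i < j) (\sum_(h < i) r h) * r i ^+ 2 <= j%:R * \sum_(i < j) r i ^+ 3.
Proof.
move=> r_ge0; elim: j => [|j IHj]; first by rewrite !big_ord0 mulr0.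
rewrite !big_ord_recr /=.
have young : 3 * ((\sum_(h < j) r h) * r j ^+ 2) <=
    \sum_(h < j) r h ^+ 3 + 2 * j%:R * r j ^+ 3.
  have -> : 2 * j%:R * r j ^+ 3 = \sum_(h < j) 2 * r j ^+ 3.
    by rewrite sumr_const card_ord -mulr_natr; ring.
  rewrite mulr_suml mulr_sumr -big_split /=; apply: ler_sum => h _.
  have := r_ge0 h; have := r_ge0 j; move: (r h) (r j) => u v v_ge0 u_ge0.
  (* The factorization of u^3 - 3 u v^2 + 2 v^3. *)
  have : 0 <= (u + 2 * v) * (u - v) ^+ 2 by rewrite mulr_ge0 ?sqr_ge0//; lra.
  by nra.
have rj3 : 0 <= r j ^+ 3 by rewrite exprn_ge0.
have r3 : 0 <= \sum_(h < j) r h ^+ 3 by apply: sumr_ge0 => h _; rewrite exprn_ge0.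
have jr : 0 <= j%:R * r j ^+ 3 by rewrite mulr_ge0.
by rewrite mulrSr; lra.
Qed.

(** The increments of [Phi] need not be negative one by one: the errors are
cancelled only after summation from the start of the epoch.  This already works
for an incomplete epoch, so the bound holds at every time [T]. *)
Lemma epoch_descent Phi q r (m : nat) (b c : R) :
  (0 < m)%N -> 0 <= b -> 2 * b * m%:R <= c ->
  (forall t, 0 <= r t) ->
  (forall k j, (j < m)%N ->
     Phi (m * k + j).+1 <= Phi (m * k + j)%N - q (m * k + j)%N / 2
       - c / 2 * r (m * k + j)%N ^+ 3
       + b * (\sum_(i < j) r (m * k + i)%N) * r (m * k + j)%N ^+ 2) ->
  forall T, Phi T + (\sum_(t < T) q t) / 2 <= Phi 0%N.
Proof.
move=> m_gt0 b_ge0 bmc r_ge0 step T.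
have within k j : (j <= m)%N ->
    Phi (m * k + j)%N + (\sum_(i < j) q (m * k + i)%N) / 2 <= Phi (m * k)%N.
  move=> jm; pose rk i := r (m * k + i)%N.
  have tele : Phi (m * k + j)%N + (\sum_(i < j) q (m * k + i)%N) / 2
      + c / 2 * (\sum_(i < j) rk i ^+ 3)
      <= Phi (m * k)%N + b * \sum_(i < j) (\sum_(h < i) rk h) * rk i ^+ 2.
    elim: j jm => [|j IHj] jm; first by rewrite !big_ord0 addn0 !mulr0 mul0r !addr0.
    rewrite !big_ord_recr /= addnS.
    by have := IHj (ltnW jm); have := step k j jm; rewrite -/(rk _); lra.
  have cubes : 0 <= \sum_(i < j) rk i ^+ 3.
    by apply: sumr_ge0 => i _; rewrite exprn_ge0 ?r_ge0.
  have bsum : b * \sum_(i < j) (\sum_(h < i) rk h) * rk i ^+ 2 <=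
      b * (m%:R * \sum_(i < j) rk i ^+ 3).
    rewrite ler_wpM2l//; apply: le_trans (sum_prefix_sqr_le rk j _) _ => [i|].
      exact: r_ge0.
    by rewrite ler_wpM2r// ler_nat.
  have : 2 * b * m%:R * (\sum_(i < j) rk i ^+ 3) <= c * (\sum_(i < j) rk i ^+ 3).
    by rewrite ler_wpM2r.
  by lra.
have across k : Phi (m * k)%N + (\sum_(t < m * k) q t) / 2 <= Phi 0%N.
  elim: k => [|k IHk]; first by rewrite muln0 big_ord0 mul0r addr0.
  rewrite mulnS addnC big_split_ord /=.
  by have := within k m (leqnn m); lra.
rewrite (divn_eq T m) mulnC big_split_ord /=.
by have := within (T %/ m)%N (T %% m)%N (ltnW (ltn_pmod T m_gt0));
  have := across (T %/ m)%N; lra.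
Qed.

End Epochs.

(** * Scalar estimates for the rate *)

Section Rate.
Context {R : realType}.

(** With a = m^(1/2) and w = eps^(-1/2) the right-hand side is
m^2 + m^(-1/2) eps^(-5/2); the two left-hand sides are eps^-2 and
m^(1/2) eps^(-3/2).  The two summands on the right balance at w = a. *)
Lemma rate_interpolation (a w : R) : 0 < a -> 0 < w ->
  w ^+ 4 <= a ^+ 4 + a^-1 * w ^+ 5 /\ a * w ^+ 3 <= a ^+ 4 + a^-1 * w ^+ 5.
Proof.
move=> a_gt0 w_gt0; have [a_ge0 w_ge0] := (ltW a_gt0, ltW w_gt0).
have [wa|/ltW aw] := leP w a.
  have rest : 0 <= a^-1 * w ^+ 5 by rewrite mulr_ge0 ?invr_ge0 ?exprn_ge0.
  have w4 : w ^+ 4 <= a ^+ 4 by rewrite ler_pXn2r.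
  have w3 : a * w ^+ 3 <= a ^+ 4 by rewrite [leRHS]exprS ler_pM2l// ler_pXn2r.
  by split; lra.
have rest : 0 <= a ^+ 4 by rewrite exprn_ge0.
have w4 : w ^+ 4 <= a^-1 * w ^+ 5.
  by rewrite [leRHS]mulrC ler_pdivlMr// [leRHS]exprSr ler_pM2l ?exprn_gt0.
have w3 : a * w ^+ 3 <= w ^+ 4 by rewrite [leRHS]exprS ler_pM2r ?exprn_gt0.
by split; lra.
Qed.

(** Used with [h] the square root of the gradient norm, for which
[l = sqrt c * h] is at most a multiple of [a * h]; dividing the last hypothesis
by [h ^+ 4] and using [h^-1 <= w] leaves the powers of [w] that
[rate_interpolation] compares. *)
Lemma rate_bound (L K a w h l q : R) :
  0 <= L -> 0 <= K -> 0 < a -> 0 < w -> 0 <= q -> 1 <= w * h ->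
  l <= K * a * h -> h ^+ 4 <= (L + l) * q ->
  1 <= (L + K) * (a ^+ 4 + a^-1 * w ^+ 5) * q.
Proof.
move=> L0 K0 a0 w0 q0 wh lK h4.
have [Y4 Y3] := rate_interpolation _ _ a0 w0; set Y := (a ^+ 4 + _) in Y4 Y3 *.
have h0 : 0 < h by rewrite -(pmulr_rgt0 _ w0); apply: lt_le_trans wh.
have h4_gt0 : 0 < h ^+ 4 by rewrite exprn_gt0.
have wh4 : 1 <= (w * h) ^+ 4 by rewrite exprn_ege1.
have wh3 : 1 <= (w * h) ^+ 3 by rewrite exprn_ege1.
have L_le : L <= L * Y * h ^+ 4.
  apply: (@le_trans _ _ (L * (w * h) ^+ 4)); first by rewrite ler_peMr.
  by rewrite exprMn mulrA ler_wpM2r ?(ltW h4_gt0)// ler_wpM2l.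
have l_le : l <= K * Y * h ^+ 4.
  apply: le_trans lK _.
  apply: (@le_trans _ _ (K * a * h * (w * h) ^+ 3)).
    by rewrite ler_peMr// !mulr_ge0 ?(ltW a0) ?(ltW h0).
  have -> : K * a * h * (w * h) ^+ 3 = K * (a * w ^+ 3) * h ^+ 4 by ring.
  by rewrite ler_wpM2r ?(ltW h4_gt0)// ler_wpM2l.
rewrite -(ler_pM2r h4_gt0) mul1r; apply: le_trans h4 _.
have -> : (L + K) * Y * q * h ^+ 4 = ((L + K) * Y * h ^+ 4) * q by ring.
by rewrite ler_wpM2r//; lra.
Qed.

End Rate.

(** * The iteration count *)

Section Convergence.
Context {R : realType} {d : nat} (F : 'cV[R]_d -> 'cV[R]_d).
Variables (L1 L2 M c : R) (m : nat) (x : nat -> 'cV[R]_d).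
Hypotheses (L1_ge0 : 0 <= L1) (L2_ge0 : 0 <= L2) (M_le : M <= c) (c_gt0 : 0 < c).
Hypotheses (m_gt0 : (0 < m)%N) (Lm_le : 4 * L1 * L2 * m%:R <= c).
Hypothesis J_le : forall u, specnorm (Jac F u) <= L1.
Hypothesis J_lip :
  forall u v, specnorm (Jac F u - Jac F v) <= L2 * enorm (u - v).
Hypothesis F_le : forall u v, enorm (F v) ^+ 2 <=
  enorm (F u + Jac F u *m (v - u)) ^+ 2 + M * enorm (v - u) ^+ 3.
Hypothesis x_step :
  forall t, x t.+1 = grlm_step F c (x (m * (t %/ m))%N) (x t).

Definition step_energy (t : nat) : R :=
  energy (Jac F (x (m * (t %/ m))%N)) (grlm_lambda F c (x t)) (x t.+1 - x t).

Lemma step_energy_ge0 t : 0 <= step_energy t.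
Proof. exact/energy_ge0/sqrtr_ge0. Qed.

Lemma grad_le_step_energy t :
  enorm (JtF F (x t)) ^+ 2 <=
  (L1 ^+ 2 + grlm_lambda F c (x t)) * step_energy t.
Proof.
apply: grad_le_energy; rewrite ?sqrtr_ge0//.
by rewrite x_step; exact: grlm_step_solves.
Qed.

Lemma drift_le k j :
  enorm (x (m * k + j)%N - x (m * k)%N) <=
  \sum_(i < j) enorm (x (m * k + i).+1 - x (m * k + i)%N).
Proof.
elim: j => [|j IHj]; first by rewrite addn0 subrr enorm0 big_ord0.
rewrite big_ord_recr /= addnS -(subrKA (x (m * k + j)%N)).
by apply: le_trans (enormD _ _) _; rewrite [leRHS]addrC lerD2l.
Qed.

Lemma sum_step_energy_le T :
  \sum_(t < T) step_energy t <= 2 * enorm (F (x 0%N)) ^+ 2.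
Proof.
suff : enorm (F (x T)) ^+ 2 + (\sum_(t < T) step_energy t) / 2
    <= enorm (F (x 0%N)) ^+ 2.
  have := sqr_ge0 (enorm (F (x T))).
  by move: (enorm (F (x T)) ^+ 2) (enorm _ ^+ 2) (\sum_(_ < _) _) => *; lra.
apply: (epoch_descent (fun t => enorm (F (x t)) ^+ 2) step_energy
  (fun t => enorm (x t.+1 - x t)) m (2 * L1 * L2) c) => //.
- by rewrite !mulr_ge0.
- by move: Lm_le; lra.
- by move=> t; exact: enorm_ge0.
move=> k j jm; set t := (m * k + j)%N.
have zt : (m * (t %/ m) = m * k)%N.
  by rewrite /t (mulnC m k) divnMDl// divn_small// addn0 mulnC.
have := grlm_descent F c (x (m * (t %/ m))%N) (x t) c_gt0 L1 L2 M L1_ge0 L2_ge0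
  M_le J_le J_lip F_le.
rewrite -x_step -/(step_energy t) zt => descent.
apply: le_trans descent _; rewrite lerD2l ler_wpM2r ?sqr_ge0//.
by rewrite ler_wpM2l ?mulr_ge0//; exact: drift_le.
Qed.

End Convergence.

Theorem theorem9 (R : realType) (L1 L2 M N0 : R)
    (hL1 : 0 <= L1) (hL2 : 0 <= L2) (hM : 0 < M) :
  exists2 C : R, 0 < C &
    forall (d : nat) (F : 'cV[R]_d -> 'cV[R]_d) (m : nat)
      (x0 : 'cV[R]_d) (x : nat -> 'cV[R]_d),
      (forall u : 'cV[R]_d, differentiable F u) ->
      (forall u : 'cV[R]_d, specnorm (Jac F u) <= L1) ->
      (forall u v : 'cV[R]_d,
         specnorm (Jac F u - Jac F v) <= L2 * enorm (u - v)) ->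
      (forall u v : 'cV[R]_d,
         enorm (F v) ^+ 2 <=
         enorm (F u + Jac F u *m (v - u)) ^+ 2 + M * enorm (v - u) ^+ 3) ->
      (1 <= m)%N ->
      enorm (F x0) = N0 ->
      GRLM F m (Num.max (4 * L1 * L2 * m%:R) M) x0 x ->
      forall (eps : R) (T : nat),
        0 < eps ->
        C * (m%:R ^+ 2 + m%:R `^ (- (1 / 2)) * eps `^ (- (5 / 2))) <= T%:R ->
        exists2 t : nat, (t < T)%N & eps_stationary F eps (x t).
Proof.
pose K := Num.sqrt (4 * L1 * L2 + M).
have K_ge0 : 0 <= K by exact: sqrtr_ge0.
have L1sq_ge0 : 0 <= L1 ^+ 2 by exact: sqr_ge0.
have S_ge0 : 0 <= 4 * L1 * L2 by rewrite !mulr_ge0.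
have C_ge0 : 0 <= 2 * N0 ^+ 2 * (L1 ^+ 2 + K).
  by rewrite mulr_ge0 ?addr_ge0// mulr_ge0 ?sqr_ge0.
exists (2 * N0 ^+ 2 * (L1 ^+ 2 + K) + 1); first exact: ltr_wpDl.
move=> d F m x0 x _ J_le J_lip F_le m_ge1 F0 [x_0 x_step] eps T eps_gt0 T_ge.
set c := Num.max _ M in x_step.
have c_gt0 : 0 < c by rewrite /c lt_max hM orbT.
have M_le : M <= c by rewrite /c le_max lexx orbT.
have Lm_le : 4 * L1 * L2 * m%:R <= c by rewrite /c le_max lexx.
have m_ge1R : 1 <= m%:R :> R by rewrite ler1n.
have m_gt0R : 0 < m%:R :> R by rewrite ltr0n.
pose a : R := Num.sqrt m%:R; pose w : R := (Num.sqrt eps)^-1.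
have a_gt0 : 0 < a by rewrite sqrtr_gt0.
have w_gt0 : 0 < w by rewrite invr_gt0 sqrtr_gt0.
(* As m >= 1, c is at most (4 L1 L2 + M) m. *)
have c_le : Num.sqrt c <= K * a.
  rewrite -sqrtrM ?addr_ge0 ?(ltW hM)// ler_sqrt ?mulr_ge0 ?addr_ge0 ?(ltW hM)//.
  have Sm_ge0 : 0 <= 4 * L1 * L2 * m%:R by rewrite mulr_ge0.
  have Mm : M <= M * m%:R by rewrite ler_peMr ?(ltW hM).
  by rewrite /c ge_max mulrDl; apply/andP; split; lra.
pose Y := a ^+ 4 + a^-1 * w ^+ 5.
have YE : m%:R ^+ 2 + m%:R `^ (- (1 / 2)) * eps `^ (- (5 / 2)) = Y.
  rewrite !powRN div1r powR12_sqrt ?(ltW m_gt0R)// -/a.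
  rewrite (_ : 5 / 2 = 2^-1 * 5%:R); last by rewrite mulrC.
  rewrite powRrM powR12_sqrt ?(ltW eps_gt0)// powR_mulrn ?sqrtr_ge0//.
  by rewrite /Y /w exprVn (exprM a 2 2) sqr_sqrtr ?(ltW m_gt0R).
have Y_gt0 : 0 < Y.
  by apply: addr_gt0; rewrite ?exprn_gt0// mulr_gt0 ?invr_gt0 ?exprn_gt0.
rewrite YE in T_ge.
(* Without a stationary point before T, every step has energy at least a fixed
   multiple of 1 / Y, and T is at most (C - 1) Y. *)
have [//|none] := pselect (exists2 t, (t < T)%N & eps_stationary F eps (x t)).
exfalso; pose q := step_energy F c m x.
have q_ge (t : 'I_T) : 1 <= (L1 ^+ 2 + K) * Y * q t.
  have G_gt : eps < enorm (JtF F (x t)).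
    by rewrite ltNge; apply/negP => st; apply: none; exists t.
  apply: (rate_bound _ _ _ _ (Num.sqrt (enorm (JtF F (x t))))
    (grlm_lambda F c (x t))) => //.
  - exact: step_energy_ge0.
  - by rewrite mulrC ler_pdivlMr ?sqrtr_gt0// mul1r ler_wsqrtr// ltW.
  - by rewrite /grlm_lambda sqrtrM ?(ltW c_gt0)// ler_wpM2r ?sqrtr_ge0.
  rewrite (exprM _ 2 2) sqr_sqrtr ?enorm_ge0//.
  exact: grad_le_step_energy.
have T_le : T%:R <= (L1 ^+ 2 + K) * Y * (2 * N0 ^+ 2).
  apply: (@le_trans _ _ (\sum_(t < T) (L1 ^+ 2 + K) * Y * q t)).
    rewrite -[X in X%:R <= _]card_ord -sumr_const; exact: ler_sum.
  have KY_ge0 : 0 <= (L1 ^+ 2 + K) * Y.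
    by apply: mulr_ge0; [exact: addr_ge0 | exact: ltW].
  rewrite -mulr_sumr ler_wpM2l// -F0 -x_0.
  exact: (sum_step_energy_le F L1 L2 M c m x).
have : (2 * N0 ^+ 2 * (L1 ^+ 2 + K) + 1) * Y <= (L1 ^+ 2 + K) * Y * (2 * N0 ^+ 2).
  exact: le_trans T_ge T_le.
rewrite mulrDl mul1r -mulrA mulrC gerDl leNgt => /negP; exact.
Qed.
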